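(* Let $n\ge 2$ be an integer and let $S_n$ be the set of all permutations of $[n]=\{1,\dots,n\}$. Then: (i) The maximum cardinality of a minimal pair-complete subset of $S_n$ is $\gamma_P(n)=\max\{n,\lfloor n^2/4\rfloor\}$. (ii) For all $n\ge 5$, the family $\mathcal{P}^*_n$ of all maximum-cardinality minimal pair-complete subsets of $S_n$ equals $\{\tau\circ Q:\tau\in S_n,\ Q\in\mathcal{Q}^*_n\}$, where $\mathcal{Q}^*_n$ is the family of all maximum-cardinality minimal inversion-complete subsets of $S_n$ and $\tau\circ Q=\{\tau\circ\pi:\pi\in Q\}$. (iii) For all $n\ge 5$ there is a bijection between $\mathcal{P}^*_n$ and the Cartesian product $\binom{[n]}{\lfloor n/2\rfloor}\times\mathcal{Q}^*_n$, where $\binom{[n]}{\lfloor n/2\rfloor}$ is the family of all subsets of $[n]$ of cardinality $\lfloor n/2\rfloor$.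
   Context: Permutations $\pi\in S_n$ are written as sequences $(\pi(1),\dots,\pi(n))$; $\tau\circ\pi$ is the composition $k\mapsto\tau(\pi(k))$. A permutation $\pi$ covers the ordered pair $(\pi(k),\pi(l))$ iff $k<l$. Let $A_n=\{(i,j): i,j\in[n], i\ne j\}$ and let an inversion be an ordered pair $(j,i)$ with $1\le i<j\le n$. A set $P\subseteq S_n$ is pair-complete if every pair in $A_n$ is covered by at least one permutation in $P$, and minimally pair-complete if moreover no proper subset of $P$ is pair-complete. Similarly $Q\subseteq S_n$ is inversion-complete if every inversion is covered by some permutation of $Q$, and minimally inversion-complete if no proper subset is inversion-complete. *)

(* Defs.v *)
From mathcomp Require Import all_boot all_fingroup.

Set Implicit Arguments.
Unset Strict Implicit.
Unset Printing Implicit Defensive.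

(* [n] is represented by 'I_n, i.e. by {0, ..., n-1}; the shift by one preserves
   the order, hence both coverage and inversions. *)

Section PairComplete.

Variable n : nat.

Definition covers (pi : 'S_n) (p : 'I_n * 'I_n) : bool :=
  [exists k : 'I_n, exists l : 'I_n, (k < l) && ((pi k, pi l) == p)].

Definition pairs : {set 'I_n * 'I_n} := [set p | p.1 != p.2].

Definition inversions : {set 'I_n * 'I_n} := [set p : 'I_n * 'I_n | p.2 < p.1].

Definition pair_complete (P : {set 'S_n}) : bool :=
  [forall p in pairs, exists pi in P, covers pi p].

Definition inversion_complete (Q : {set 'S_n}) : bool :=
  [forall p in inversions, exists pi in Q, covers pi p].

Definition min_pair_complete (P : {set 'S_n}) : bool := minset pair_complete P.

Definition min_inversion_complete (Q : {set 'S_n}) : bool :=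
  minset inversion_complete Q.

Definition gammaP : nat := \max_(P : {set 'S_n} | min_pair_complete P) #|P|.

Definition gammaQ : nat :=
  \max_(Q : {set 'S_n} | min_inversion_complete Q) #|Q|.

Definition Pstar : {set {set 'S_n}} :=
  [set P | min_pair_complete P & #|P| == gammaP].

Definition Qstar : {set {set 'S_n}} :=
  [set Q | min_inversion_complete Q & #|Q| == gammaQ].

(* The product of permutations applies its left factor first, so
   (pi * tau) k = tau (pi k), which is the composite of tau after pi. *)
Definition compset (tau : 'S_n) (Q : {set 'S_n}) : {set 'S_n} :=
  [set (pi * tau)%g | pi in Q].

End PairComplete.

(* Main.v *)
Require Import Defs.
From mathcomp Require Import all_boot all_fingroup zify.

(* In a minimal complete family P each permutation has a private pair; choosing
   one for each gives an oriented graph C with |C| = |P| such that every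
   permutation of P reverses all edges of C but one.  Hence C has no directed
   cycle shorter than |C|, and no directed path bypasses an edge of C.  So C is
   triangle-free if |P| > 3, and Mantel's theorem gives |P| <= n^2/4.  In the
   case of equality with n >= 5, C is an orientation of a complete bipartite
   graph, and pair-completeness rules out directed paths of length 2, so C
   consists of all pairs from a set A, determined by P, to its complement.
   Relabelling A as a final segment makes all pairs of C inversions and turns P
   into a maximum minimal inversion-complete set; conversely such a set is
   pair-complete, because any two vertices of C are adjacent or have a common
   neighbour.  Relabelling thus matches the members of P* with a given source A
   with the members of Q* whose source has |A| elements; as |A| is n/2 rounded
   down or up, each member of Q* arises from 'C(n, n/2) sets A. *)

Set Implicit Arguments.
Unset Strict Implicit.
Unset Printing Implicit Defensive.

Definition path_edges (T : Type) (x : T) (p : seq T) : seq (T * T) :=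
  zip (belast x p) p.

Section Cuts.

Variable T : finType.
Implicit Types (A : {set T}) (x y : T).

Definition cut A : {set T * T} := setX A (~: A).

Lemma in_cut A x y : ((x, y) \in cut A) = (x \in A) && (y \notin A).
Proof. by rewrite in_setX in_setC. Qed.

Lemma card_cut A : #|cut A| = #|A| * #|~: A|.
Proof. exact: cardsX. Qed.

Lemma cut_imset (s : {perm T}) A :
  cut (s @: A) = [set (s p.1, s p.2) | p in cut A].
Proof.
apply/setP=> -[x y]; rewrite in_cut -[x](permKV s) -[y](permKV s).
rewrite !(mem_imset _ _ perm_inj); apply/idP/imsetP=> [xy|[[u v]]].
  by exists ((s^-1)%g x, (s^-1)%g y); rewrite ?in_cut.
by rewrite in_cut => uv [/perm_inj -> /perm_inj ->].
Qed.

End Cuts.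

Section OrientedGraphs.

Variables (T : finType) (C : {set T * T}).

Definition edge : rel T := fun x y => (x, y) \in C.
Definition adj : rel T := fun x y => edge x y || edge y x.

Definition oriented := forall x y, edge x y -> ~~ edge y x.
Definition triangle_free := forall x y z, adj x y -> adj y z -> ~~ adj x z.
Definition independent (N : {set T}) := {in N &, forall x y, ~~ adj x y}.
Definition complete_bipartite (N : {set T}) :=
  forall x y, adj x y = ((x \in N) != (y \in N)).

Definition neighbours (x : T) : {set T} := [set y | adj x y].

Definition incidences (D : {set T}) : {set T * T} :=
  [set e | (e.1 \in D) && adj e.1 e.2].

Lemma adjC x y : adj x y = adj y x.
Proof. exact: orbC. Qed.

Lemma card_incidences D : #|incidences D| = \sum_(x in D) #|neighbours x|.
Proof.
under eq_bigr do rewrite -sum1dep_card.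
by rewrite pair_big_dep /= sum1dep_card.
Qed.

Lemma neighbours_independent x : triangle_free -> independent (neighbours x).
Proof.
move=> C_trifree y z; rewrite !inE => xy xz.
by rewrite adjC in xy; apply: C_trifree xy xz.
Qed.

(* Every edge has an end outside an independent set [N]; [turn_out N] lets it
   start there. *)
Definition turn_out (N : {set T}) (e : T * T) : T * T :=
  if e.1 \in N then (e.2, e.1) else e.

Lemma turn_out_inj N : oriented -> {in C &, injective (turn_out N)}.
Proof.
move=> C_oriented [a b] [c d] ab cd; rewrite /turn_out /=.
by case: ifP => _; case: ifP => _ [? ?]; subst=> //;
  have := C_oriented _ _ ab; rewrite /edge cd.
Qed.

Lemma turn_out_incidences N :
  independent N -> turn_out N @: C \subset incidences (~: N).
Proof.
move=> indepN; apply/subsetP=> _ /imsetP[[x y] xyC ->].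
have xy : adj x y by rewrite /adj /edge xyC.
rewrite inE /turn_out /=; case: ifP => xN /=.
  rewrite in_setC adjC xy andbT.
  by apply: contraTN xy => yN; apply: indepN.
by rewrite in_setC xN.
Qed.

Lemma card_le_incidences N :
  oriented -> independent N -> #|C| <= #|incidences (~: N)|.
Proof.
move=> C_oriented indepN.
rewrite -(card_in_imset (turn_out_inj (N := N) C_oriented)).
exact/subset_leq_card/turn_out_incidences.
Qed.

Lemma independent_setC N :
    oriented -> independent N -> #|incidences (~: N)| = #|C| ->
  independent (~: N).
Proof.
move=> C_oriented indepN cardC.
have imC : turn_out N @: C = incidences (~: N).
  apply/eqP; rewrite eqEcard turn_out_incidences //= cardC.
  by rewrite (card_in_imset (turn_out_inj (N := N) C_oriented)).
have adj_edge x y : x \in ~: N -> y \in ~: N -> adj x y -> edge x y.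
  move=> xN yN xy; have : (x, y) \in incidences (~: N) by rewrite inE xN.
  rewrite -imC => /imsetP[[a b] abC]; rewrite /turn_out /=.
  by case: ifP => aN [xE yE]; [rewrite yE inE aN in yN | rewrite xE yE].
move=> x y xN yN; apply/negP=> xy.
have := C_oriented x y (adj_edge x y xN yN xy).
by rewrite adj_edge // adjC.
Qed.

Lemma complete_bipartite_card N :
    independent N -> independent (~: N) ->
    #|incidences (~: N)| = #|N| * #|~: N| ->
  complete_bipartite N.
Proof.
move=> indepN indepNC cardE.
have incidencesE : incidences (~: N) = setX (~: N) N.
  apply/eqP; rewrite eqEcard cardsX mulnC cardE leqnn andbT.
  apply/subsetP=> -[x y]; rewrite in_setX inE => /andP[xN xy]; rewrite xN.
  by apply: contraTT xy => yN; apply: indepNC; rewrite // inE.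
have adjE x y : x \notin N -> y \in N -> adj x y.
  move=> xN yN; have : (x, y) \in incidences (~: N).
    by rewrite incidencesE in_setX inE xN.
  by rewrite inE => /andP[].
move=> x y; have [xN|xN] := boolP (x \in N); have [yN|yN] := boolP (y \in N).
- exact/negbTE/indepN.
- by rewrite adjC adjE.
- by rewrite adjE.
- by apply/negbTE/indepNC; rewrite inE.
Qed.

Lemma mantel : oriented -> triangle_free ->
  exists N : {set T}, #|C| <= #|N| * #|~: N| /\
    (#|C| = #|N| * #|~: N| -> complete_bipartite N).
Proof.
move=> C_oriented C_trifree.
have [x0 _|T0] := pickP (@predT T); last first.
  exists set0; split=> [|_ x]; last by have := T0 x.
  by rewrite [#|C|]eq_card0 // => -[x y]; have := T0 x.
have [v _ max_v] := @arg_maxnP T x0 predT (fun x => #|neighbours x|) isT.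
have indepN : independent (neighbours v) by apply: neighbours_independent.
exists (neighbours v); move: (neighbours v) max_v indepN => N max_N indepN.
have leC := card_le_incidences C_oriented indepN.
have leE : #|incidences (~: N)| <= #|N| * #|~: N|.
  rewrite card_incidences mulnC -sum_nat_const leq_sum // => x _.
  exact: max_N.
split=> [|cardC]; first exact: leq_trans leE.
have cardE : #|incidences (~: N)| = #|C|.
  by apply/eqP; rewrite eqn_leq leC cardC leE.
apply: complete_bipartite_card => //; last by rewrite cardE.
exact: independent_setC.
Qed.

Lemma bipartite_other_middle N x y z :
    complete_bipartite N -> 1 < #|N| -> 1 < #|~: N| -> adj x y -> adj y z ->
  exists2 w, w != y & adj x w && adj w z.
Proof.
move=> adjE N2 NC2 xy yz; pose D := [set u | (u \in N) == (y \in N)].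
have /set0Pn[w] : D :\ y != set0.
  have D2 : 1 < #|D|.
    suff -> : D = if y \in N then N else ~: N by case: ifP.
    by apply/setP=> u; case: ifP => yN; rewrite !inE yN ?eqb_id ?eqbF_neg.
  by rewrite -card_gt0 -(ltn_add2l 1); rewrite (cardsD1 y) inE eqxx in D2.
rewrite !inE => /andP[wy /eqP wN]; exists w => //.
by move: xy yz; rewrite !adjE wN => -> ->.
Qed.

Lemma bipartite_common_neighbour N x y :
    complete_bipartite N -> 0 < #|N| -> 0 < #|~: N| -> ~~ adj x y ->
  exists z, adj x z && adj y z.
Proof.
move=> adjE /card_gt0P[a aN] /card_gt0P[b /[!inE] bN].
rewrite adjE negbK => /eqP xy.
exists (if x \in N then b else a); rewrite !adjE -xy.
by case: ifP; rewrite ?aN ?(negbTE bN).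
Qed.

Lemma oriented_bipartite_cut N :
    complete_bipartite N -> (forall x y z, edge x y -> ~~ edge y z) ->
  exists A, C = cut A.
Proof.
move=> bipN no_path2; exists [set x | [exists y, edge x y]].
apply/setP=> -[x y]; rewrite in_cut !inE negb_exists -/(edge x y).
apply/idP/andP=> [xy|[/existsP[w xw] /forallP y_sink]].
  by split; [apply/existsP; exists y | apply/forallP=> z; apply: no_path2 xy].
have w_sink := no_path2 _ _ _ xw.
have : adj x w by rewrite /adj xw.
have : ~~ adj y w by rewrite /adj negb_or y_sink w_sink.
have : edge x y = adj x y by rewrite /adj (negbTE (y_sink x)) orbF.
by rewrite !bipN => ->; do 3!case: (_ \in N).
Qed.

End OrientedGraphs.

Section Covers.

Variables (S U : finType) (cov : S -> pred U).

Definition complete_for (T : {set U}) (P : {set S}) : bool :=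
  [forall c in T, exists s in P, cov s c].

Definition covered_for (C : {set U}) (s : S) : {set U} :=
  [set c in C | cov s c].

Definition coverers_for (P : {set S}) (c : U) : {set S} :=
  [set s in P | cov s c].

Definition critical_for (P : {set S}) (C : {set U}) : bool :=
  [forall s in P, #|covered_for C s| == 1] &&
  [forall c in C, #|coverers_for P c| == 1].

Definition gamma_for (T : {set U}) : nat :=
  \max_(P : {set S} | minset (complete_for T) P) #|P|.

Lemma completeP (T : {set U}) (P : {set S}) :
  reflect {in T, forall c, exists2 s, s \in P & cov s c} (complete_for T P).
Proof. by apply: (iffP forall_inP) => cP c /cP /exists_inP. Qed.

Lemma complete_subset (T T' : {set U}) (P : {set S}) :
  T \subset T' -> complete_for T' P -> complete_for T P.
Proof. by move=> /subsetP TT' /forall_inP cP; apply/forall_inP=> c /TT'/cP. Qed.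

Lemma sum_card_covered (P : {set S}) (C : {set U}) :
  \sum_(s in P) #|covered_for C s| = \sum_(c in C) #|coverers_for P c|.
Proof.
under eq_bigr do rewrite -sum1dep_card big_mkcondr.
rewrite exchange_big; apply: eq_bigr => c _.
by rewrite -sum1dep_card [RHS]big_mkcondr.
Qed.

Lemma critical_covered P C s :
  critical_for P C -> s \in P -> exists c, covered_for C s = [set c].
Proof. by case/andP=> /forall_inP uniqC _ /uniqC/cards1P. Qed.

Lemma critical_coverers P C c :
  critical_for P C -> c \in C -> exists s, coverers_for P c = [set s].
Proof. by case/andP=> _ /forall_inP uniqP /uniqP/cards1P. Qed.

Lemma critical_coverer P C c :
  critical_for P C -> c \in C -> exists2 s, s \in P & covered_for C s = [set c].
Proof.
move=> crit cC; have [s /setP/(_ s)] := critical_coverers crit cC.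
rewrite !inE eqxx => /andP[sP sc]; exists s => //.
have [d covE] := critical_covered crit sP; rewrite covE.
by have /setP/(_ c) := covE; rewrite !inE cC sc => /esym/eqP ->.
Qed.

Lemma critical_coverer_inj P C c s t :
    critical_for P C -> c \in C -> s \in P -> t \in P -> cov s c -> cov t c ->
  s = t.
Proof.
move=> crit cC sP tP sc tc.
have [u /setP coverersE] := critical_coverers crit cC.
have := coverersE s; have := coverersE t; rewrite !inE sP tP sc tc.
by move=> /esym/eqP -> /esym/eqP ->.
Qed.

Lemma critical_card P C : critical_for P C -> #|C| = #|P|.
Proof.
case/andP=> /forall_inP uniqC /forall_inP uniqP; have := sum_card_covered P C.
under eq_bigr => s sP do rewrite (eqP (uniqC s sP)).
under [RHS]eq_bigr => c cC do rewrite (eqP (uniqP c cC)).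
by rewrite !sum1_card.
Qed.

Lemma minset_complete_private (T : {set U}) (P : {set S}) s :
    minset (complete_for T) P -> s \in P ->
  exists2 c, c \in T & coverers_for P c = [set s].
Proof.
case/minsetP=> /completeP cP minP sP.
have : ~~ complete_for T (P :\ s).
  by apply: contraL sP => /minP/(_ (subsetDl _ _)) <-; rewrite setD11.
case/forall_inPn=> c cT /exists_inPn others; exists c => //.
have [t tP tc] := cP c cT.
apply/eqP; rewrite eqEsubset sub1set inE sP /= andbC; apply/andP; split.
  suff <- : t = s by [].
  by apply: contraTeq tc => ts; apply: others; rewrite !inE ts.
apply/subsetP=> u; rewrite !inE => /andP[uP uc].
by apply: contraTT uc => us; apply: others; rewrite !inE us.
Qed.

Lemma minset_complete_critical (T : {set U}) (P : {set S}) :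
    minset (complete_for T) P ->
  exists2 C : {set U}, C \subset T & critical_for P C.
Proof.
move=> minP; have [->|[s0 s0P]] := set_0Vmem P.
  exists set0; first exact: sub0set.
  by apply/andP; split; apply/forall_inP=> ?; rewrite inE.
have [c0 _ _] := minset_complete_private minP s0P.
have private s : exists c, s \in P -> c \in T /\ coverers_for P c = [set s].
  have [sP|_] := boolP (s \in P); last by exists c0.
  by have [c cT cE] := minset_complete_private minP sP; exists c.
have [f fP] := fin_all_exists private.
exists (f @: P); first by apply/subsetP=> _ /imsetP[s /fP[fsT _] ->].
apply/andP; split; apply/forall_inP; last first.
  by move=> _ /imsetP[s /fP[_ fsE] ->]; rewrite fsE cards1.
move=> s sP; apply/cards1P; exists (f s); apply/setP=> c; rewrite !inE.
apply/andP/eqP=> [[/imsetP[t /fP[_ /setP/(_ s) tE] ->] sc]|->].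
  by move: tE; rewrite !inE sP sc => /esym/eqP ->.
by rewrite imset_f //; have [_ /setP/(_ s)] := fP s sP; rewrite !inE sP eqxx.
Qed.

Lemma minset_completeP (T : {set U}) (P : {set S}) :
  reflect (complete_for T P /\
           exists2 C : {set U}, C \subset T & critical_for P C)
          (minset (complete_for T) P).
Proof.
apply: (iffP idP) => [minP|[cP [C /subsetP CT crit]]].
  by split; [exact: minsetp minP | exact: minset_complete_critical].
apply/minsetP; split=> // Q /completeP cQ QP.
apply/eqP; rewrite eqEsubset QP /=; apply/subsetP=> s sP.
have [c /setP/(_ c)] := critical_covered crit sP.
rewrite !inE eqxx => /andP[cC sc]; have [t tQ tc] := cQ c (CT c cC).
by rewrite (critical_coverer_inj crit cC sP (subsetP QP t tQ) sc tc).
Qed.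

(* Any family of elements covering at most one member of [C] each needs #|C| of
   them to cover [C]. *)
Lemma gamma_ge (T C : {set U}) :
    C \subset T ->
    {in T, forall u, exists2 s, cov s u & #|covered_for C s| <= 1} ->
  #|C| <= gamma_for T.
Proof.
move=> /subsetP CT sparse.
have /minset_exists[P minP /subsetP PS] :
    complete_for T [set s | #|covered_for C s| <= 1].
  by apply/completeP=> u /sparse[s su s1]; exists s; rewrite ?inE.
have /completeP cP := minsetp minP.
apply: leq_trans (leq_bigmax_cond (F := fun P : {set S} => #|P|) P minP).
rewrite -[#|C|]sum1_card -[#|P|]sum1_card.
apply: (@leq_trans (\sum_(c in C) #|coverers_for P c|)).
  apply: leq_sum => c /CT/cP[s sP sc].
  by apply/card_gt0P; exists s; rewrite inE sP.
by rewrite -sum_card_covered leq_sum // => s /PS; rewrite inE.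
Qed.

End Covers.

Lemma imset_setId (U U' : finType) (k : U -> U') (p : pred U) (p' : pred U')
    (C : {set U}) :
  (forall c, p' (k c) = p c) ->
  [set d in k @: C | p' d] = k @: [set c in C | p c].
Proof.
move=> pE; apply/setP=> d; rewrite inE.
apply/andP/imsetP=> [[/imsetP[c cC ->]]|[c /setIdP[cC pc] ->]].
  by rewrite pE => pc; exists c; rewrite ?inE ?cC.
by rewrite pE imset_f.
Qed.

Lemma critical_imset (S U S' U' : finType)
    (cov : S -> pred U) (cov' : S' -> pred U') (h : S -> S') (k : U -> U')
    (P : {set S}) (C : {set U}) :
    injective h -> injective k -> (forall s c, cov' (h s) (k c) = cov s c) ->
  critical_for cov P C -> critical_for cov' (h @: P) (k @: C).
Proof.
move=> h_inj k_inj covE /andP[/forall_inP uniqC /forall_inP uniqP].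
apply/andP; split; apply/forall_inP=> _ /imsetP[x xin ->].
  by rewrite /covered_for (imset_setId _ (covE x)) card_imset ?uniqC.
by rewrite /coverers_for (imset_setId (p := cov^~ x)) ?card_imset ?uniqP.
Qed.

(* Up to conversion, [pair_complete], [inversion_complete] and [gammaP n] are
   [complete (pairs n)], [complete (inversions n)] and [gamma (pairs n)]. *)
Local Notation complete := (complete_for (@covers _)).
Local Notation covered := (covered_for (@covers _)).
Local Notation critical := (critical_for (@covers _)).
Local Notation gamma := (gamma_for (@covers _)).

Section Coverage.

Variable n : nat.
Implicit Types (pi tau : 'S_n) (x y z : 'I_n).

Lemma coversE pi x y : covers pi (x, y) = ((pi^-1)%g x < (pi^-1)%g y).
Proof.
apply/existsP/idP => [[k /existsP[l /andP[kl /eqP[<- <-]]]]|xy].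
  by rewrite !permK.
exists ((pi^-1)%g x); apply/existsP; exists ((pi^-1)%g y).
by rewrite xy !permKV eqxx.
Qed.

Lemma coversN pi x y : x != y -> covers pi (y, x) = ~~ covers pi (x, y).
Proof.
by rewrite !coversE; case: ltngtP => // /val_inj/perm_inj ->; rewrite eqxx.
Qed.

Lemma covers_asym pi x y : covers pi (x, y) -> ~~ covers pi (y, x).
Proof. by rewrite !coversE -leqNgt => /ltnW. Qed.

Lemma covers_trans pi y x z :
  covers pi (x, y) -> covers pi (y, z) -> covers pi (x, z).
Proof. by rewrite !coversE; apply: ltn_trans. Qed.

Lemma coversM pi tau x y :
  covers (pi * tau)%g (tau x, tau y) = covers pi (x, y).
Proof. by rewrite !coversE invMg !permM !permK. Qed.

Lemma exists_perm_sorting (r : 'I_n -> nat) :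
  exists pi, forall x y, covers pi (x, y) -> r x <= r y.
Proof.
pose s := sort (relpre r leq) (enum 'I_n).
have in_s x : x \in s by rewrite mem_sort mem_enum.
have index_lt x : index x s < n.
  by rewrite -[ltnRHS]size_enum_ord -(size_sort (relpre r leq)) index_mem.
have index_ord_inj : injective (fun x => Ordinal (index_lt x)).
  by move=> x y [] /index_inj; apply.
exists (perm index_ord_inj)^-1%g => x y; rewrite coversE invgK !permE /=.
apply: (sorted_ltn_index (leT := relpre r leq)) => //.
  by move=> y' x' z'; apply: leq_trans.
by apply: sort_sorted => x' y'; apply: leq_total.
Qed.

Lemma exists_perm_of_rank (r : 'I_n -> nat) :
  exists pi, (forall x y, r x < r y -> covers pi (x, y)) /\
             (forall x y, covers pi (x, y) -> r x <= r y).
Proof.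
have [pi sorting] := exists_perm_sorting r; exists pi; split=> // x y xy.
have yx : y != x by apply: contraTneq xy => ->; rewrite ltnn.
by rewrite coversN //; apply/negP=> /sorting; rewrite leqNgt xy.
Qed.

Lemma pairs_neq (C : {set 'I_n * 'I_n}) x y :
  C \subset pairs n -> edge C x y -> x != y.
Proof. by move=> C_pairs /(subsetP C_pairs); rewrite inE. Qed.

Lemma inversions_pairs : inversions n \subset pairs n.
Proof.
by apply/subsetP=> -[x y]; rewrite !inE /= -val_eqE neq_ltn orbC => ->.
Qed.

Lemma reverse_path (C : {set 'I_n * 'I_n}) pi c x p :
    C \subset pairs n -> covered C pi = [set c] ->
    path (edge C) x p -> c \notin path_edges x p -> p != [::] ->
  covers pi (last x p, x).
Proof.
move=> C_pairs /setP covE.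
elim: p x => //= y p IHp x /andP[xy yp]; rewrite inE negb_or => /andP[cxy cp] _.
have yx : covers pi (y, x).
  rewrite coversN ?(pairs_neq C_pairs xy) //; have := covE (x, y).
  by rewrite !inE -/(edge C x y) xy eq_sym (negbTE cxy) /= => ->.
have [-> //|p_neq0] := eqVneq p [::].
exact: covers_trans (IHp y yp cp p_neq0) yx.
Qed.

End Coverage.

Definition transitive_pairs n (T : {set 'I_n * 'I_n}) :=
  forall x y z, (x, y) \in T -> (y, z) \in T -> x != z -> (x, z) \in T.

Lemma pairs_transitive n : transitive_pairs (pairs n).
Proof. by move=> x y z; rewrite !inE. Qed.

Lemma inversions_transitive n : transitive_pairs (inversions n).
Proof. by move=> x y z; rewrite !inE => yx zy _; apply: ltn_trans zy yx. Qed.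

Section CriticalPairs.

Variables (n : nat) (P : {set 'S_n}) (C : {set 'I_n * 'I_n}).
Hypotheses (crit : critical P C) (C_pairs : C \subset pairs n).

Lemma critical_covers x y :
    edge C x y ->
  exists2 pi, pi \in P & covers pi (x, y) /\ covered C pi = [set (x, y)].
Proof.
move=> xy; have [pi piP covE] := critical_coverer crit xy; exists pi => //.
by split=> //; have /setP/(_ (x, y)) := covE; rewrite !inE eqxx => /andP[].
Qed.

Lemma critical_covers_reverse x y u v :
    edge C x y -> edge C u v -> (u, v) != (x, y) ->
  exists2 pi, pi \in P & covers pi (x, y) /\ covers pi (v, u).
Proof.
move=> xy uv neq; have [pi piP [cov_xy covE]] := critical_covers xy.
exists pi => //; split=> //.
apply: (reverse_path (p := [:: v]) C_pairs covE) => //; first by rewrite /= uv.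
by rewrite inE eq_sym.
Qed.

Lemma critical_reverse_path x p :
    path (edge C) x p -> size p < #|C| -> p != [::] ->
  exists2 pi, pi \in P & covers pi (last x p, x).
Proof.
move=> xp pC p_neq0.
have [c cC cp] : exists2 c, c \in C & c \notin path_edges x p.
  apply/subsetPn; apply: contraL pC => /subset_leq_card; rewrite -leqNgt.
  move/leq_trans; apply; apply: leq_trans (card_size _) _.
  by rewrite size_zip size_belast minnn.
have [pi piP covE] := critical_coverer crit cC.
by exists pi => //; apply: reverse_path covE xp cp p_neq0.
Qed.

Lemma critical_acyclic x p :
  size p < #|C| -> p != [::] -> path (edge C) x p -> last x p != x.
Proof.
move=> pC p_neq0 xp; have [pi _] := critical_reverse_path xp pC p_neq0.
by apply: contraTneq => ->; rewrite coversE ltnn.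
Qed.

Lemma critical_no_shortcut x y p :
  edge C x y -> path (edge C) x p -> last x p = y -> (x, y) \in path_edges x p.
Proof.
move=> xy xp py; have [pi _ [cov_xy covE]] := critical_covers xy.
apply: contraLR cov_xy => xy_notin; rewrite covers_asym // -py.
apply: reverse_path covE xp xy_notin _ => //.
by apply: contraNneq (pairs_neq C_pairs xy) => p0; rewrite -py p0.
Qed.

Lemma critical_paths_meet pi x p q :
    pi \in P -> covers pi (x, last x p) -> last x q = last x p ->
    path (edge C) x p -> path (edge C) x q ->
  has [in path_edges x p] (path_edges x q).
Proof.
move=> piP cov_xp qp xp xq; have [c covE] := critical_covered crit piP.
have covered_on s :
    last x s = last x p -> path (edge C) x s -> c \in path_edges x s.
  move=> sp xs; have s_neq0 : s != [::].
    by apply: contraTneq cov_xp => s0; rewrite -sp s0 coversE ltnn.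
  apply: contraLR cov_xp => cs; rewrite covers_asym // -sp.
  exact: reverse_path covE xs cs s_neq0.
by apply/hasP; exists c; apply: covered_on.
Qed.

Lemma critical_oriented : 2 < #|C| -> oriented C.
Proof.
move=> C2 x y xy; apply/negP=> yx.
have := @critical_acyclic x [:: y; x] C2 isT.
by rewrite /= xy yx eqxx => /(_ isT).
Qed.

Lemma critical_triangle_free : 3 < #|C| -> triangle_free C.
Proof.
move=> C3.
have transitive x y z : edge C x y -> edge C y z -> edge C x z -> False.
  move=> xy yz xz.
  have := @critical_no_shortcut x z [:: y; z] xz.
  rewrite /= xy yz => /(_ isT erefl); rewrite !inE !xpair_eqE eqxx.
  rewrite (eq_sym z) (negbTE (pairs_neq C_pairs xy)).
  by rewrite (negbTE (pairs_neq C_pairs yz)).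
have cyclic x y z : edge C x y -> edge C y z -> edge C z x -> False.
  move=> xy yz zx; have := @critical_acyclic x [:: y; z; x] C3 isT.
  by rewrite /= xy yz zx eqxx => /(_ isT).
by move=> x y z /orP[?|?] /orP[?|?]; apply/negP=> /orP[?|?]; eauto.
Qed.

Lemma critical_no_path2 N :
    4 < #|C| -> pair_complete P ->
    complete_bipartite C N -> 1 < #|N| -> 1 < #|~: N| ->
  forall x y z, edge C x y -> ~~ edge C y z.
Proof.
move=> C4 /completeP cP bipN N2 NC2 x y z xy; apply/negP=> yz.
have C_oriented : oriented C by apply: critical_oriented; lia.
have xz : x != z by apply: contraTneq yz => <-; apply: C_oriented.
have [||w wy] := bipartite_other_middle (x := x) (y := y) (z := z) bipN N2 NC2.
- by rewrite /adj xy.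
- by rewrite /adj yz.
have neqE := (eq_sym y w, eq_sym y x, eq_sym z x, eq_sym z y,
  negbTE wy, negbTE xz,
  negbTE (pairs_neq C_pairs xy), negbTE (pairs_neq C_pairs yz)).
case/andP=> /orP[xw|wx] /orP[wz|zw].
- have [pi piP cov_xz] : exists2 pi, pi \in P & covers pi (x, z).
    by apply: cP; rewrite inE.
  have := @critical_paths_meet pi x [:: y; z] [:: w; z] piP cov_xz erefl.
  by rewrite /= xy yz xw wz !inE !xpair_eqE !neqE !andbF => /(_ isT isT).
- have := @critical_no_shortcut x w [:: y; z; w] xw.
  by rewrite /= xy yz zw !inE !xpair_eqE !neqE !andbF => /(_ isT erefl).
- have := @critical_no_shortcut w z [:: x; y; z] wz.
  by rewrite /= wx xy yz !inE !xpair_eqE !neqE !andbF => /(_ isT erefl).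
- have := @critical_acyclic x [:: y; z; w; x] C4 isT.
  by rewrite /= xy yz zw wx eqxx => /(_ isT).
Qed.

End CriticalPairs.

Lemma leq_mul_sqr_div4 a b : a * b <= (a + b) ^ 2 %/ 4.
Proof. by rewrite leq_divRL // mulnC nat_AGM2. Qed.

Lemma sqr_div4 n : n ^ 2 %/ 4 = n %/ 2 * (n - n %/ 2).
Proof.
have := divn_eq n 2; have := ltn_pmod n (isT : 0 < 2).
move: (n %/ 2) (n %% 2) => k e e2 ->.
have -> : (k * 2 + e) ^ 2 = k * (k + e) * 4 + e * e by rewrite -mulnn; lia.
rewrite divnMDl // divn_small; last by case: e e2 => [|[|]].
by rewrite addn0; congr (_ * _); lia.
Qed.

Lemma leq_sqr_div4 n : 3 < n -> n <= n ^ 2 %/ 4.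
Proof. by move=> n3; rewrite leq_divRL //; nia. Qed.

Lemma ltn_sqr_div4 n : 4 < n -> n < n ^ 2 %/ 4.
Proof. by move=> n4; rewrite leq_divRL //; nia. Qed.

Lemma factors_gt1 a b : a + b < a * b -> 1 < a /\ 1 < b.
Proof. by case: a b => [|[|a]] [|[|b]]; lia. Qed.

Lemma sqr_div4_factor n a b :
  a + b = n -> a * b = n ^ 2 %/ 4 -> a = n %/ 2 \/ a = n - n %/ 2.
Proof.
move=> <- abE.
have {abE} lt_ab : (a + b) ^ 2 < 4 * (a * b) + 4 by rewrite abE; lia.
have ab : a <= b + 1 by nia.
have ba : b <= a + 1 by nia.
by lia.
Qed.

Lemma cut_pairs n (A : {set 'I_n}) : cut A \subset pairs n.
Proof.
apply/subsetP=> -[x y]; rewrite in_cut inE /= => /andP[xA].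
by apply: contraNneq => <-.
Qed.

Section ExtremalCriticalPairs.

Variables (n : nat) (P : {set 'S_n}) (C : {set 'I_n * 'I_n}).
Hypotheses (crit : critical P C) (C_pairs : C \subset pairs n).

Lemma critical_card_le : 3 < #|P| -> #|P| <= n ^ 2 %/ 4.
Proof.
rewrite -(critical_card crit) => C3.
have C_oriented := critical_oriented crit C_pairs (ltnW C3).
have [N [leC _]] := mantel C_oriented (critical_triangle_free crit C_pairs C3).
rewrite (leq_trans leC) // -[n in n ^ 2]card_ord -(cardsC N).
exact: leq_mul_sqr_div4.
Qed.

Hypotheses (n4 : 4 < n) (cardC : #|C| = n ^ 2 %/ 4).

Lemma extremal_critical_gt4 : 4 < #|C|.
Proof. by rewrite cardC (leq_trans n4) // ltnW // ltn_sqr_div4. Qed.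

Lemma extremal_critical_bipartite :
  exists N : {set 'I_n}, [/\ 1 < #|N|, 1 < #|~: N| & complete_bipartite C N].
Proof.
have C3 := ltnW extremal_critical_gt4.
have C_oriented := critical_oriented crit C_pairs (ltnW C3).
have C_trifree := critical_triangle_free crit C_pairs C3.
have [N [leC bipN]] := mantel C_oriented C_trifree.
have cardN : #|N| + #|~: N| = n by rewrite cardsC card_ord.
have [N2 NC2] : 1 < #|N| /\ 1 < #|~: N|.
  by apply: factors_gt1; rewrite cardN (leq_trans _ leC) // cardC ltn_sqr_div4.
exists N; split=> //; apply: bipN; apply/eqP.
by rewrite eqn_leq leC cardC -[n in n ^ 2]cardN leq_mul_sqr_div4.
Qed.

Lemma extremal_critical_cut : pair_complete P -> exists A, C = cut A.
Proof.
move=> cP; have [N [N2 NC2 bipN]] := extremal_critical_bipartite.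
apply: (oriented_bipartite_cut bipN).
exact: (critical_no_path2 crit C_pairs extremal_critical_gt4 cP bipN N2 NC2).
Qed.

Lemma extremal_critical_pair_complete (T : {set 'I_n * 'I_n}) :
  C \subset T -> transitive_pairs T -> complete T P -> pair_complete P.
Proof.
move=> /subsetP CT T_trans /completeP cP.
have C2 : 2 < #|C| by rewrite (ltn_trans _ extremal_critical_gt4).
have [N [/ltnW N1 /ltnW NC1 bipN]] := extremal_critical_bipartite.
have reversed x p := critical_reverse_path (x := x) (p := p) crit C_pairs.
apply/completeP=> -[x y]; rewrite inE /= => xy.
have [/orP[xyC|yxC]|] := boolP (adj C x y).
- by apply: cP; apply: CT.
- by apply: (reversed y [:: x]); rewrite //= ?yxC // (ltn_trans _ C2).
case/(bipartite_common_neighbour bipN N1 NC1)=> z.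
case/andP=> /orP[xz|zx] /orP[yz|zy].
- have [|pi piP [cov_xz cov_zy]] := critical_covers_reverse crit C_pairs xz yz.
    by rewrite xpair_eqE eqxx andbT eq_sym.
  by exists pi => //; apply: covers_trans cov_xz cov_zy.
- by apply: cP; apply: T_trans xy; apply: CT; [exact: xz | exact: zy].
- by apply: (reversed y [:: z; x]); rewrite //= yz zx.
- have [|pi piP [cov_zy cov_xz]] := critical_covers_reverse crit C_pairs zy zx.
    by rewrite xpair_eqE eqxx.
  by exists pi => //; apply: covers_trans cov_xz cov_zy.
Qed.

End ExtremalCriticalPairs.

Section LowerBounds.

Variable n : nat.

Lemma cut_sparse (A : {set 'I_n}) (p : 'I_n * 'I_n) :
    p \in pairs n ->
  exists2 pi : 'S_n, covers pi p & #|covered (cut A) pi| <= 1.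
Proof.
case: p => i j; rewrite inE /= => ij.
pose r x := if x \in A then if x == i then 1 else 3
            else if x == j then 2 else 0.
have [pi [covers_of_r r_of_covers]] := exists_perm_of_rank r; exists pi.
  apply: covers_of_r; rewrite /r !eqxx (negbTE ij) eq_sym (negbTE ij).
  by do 2!case: ifP.
rewrite -(cards1 (i, j)); apply/subset_leq_card/subsetP=> -[x y] /setIdP[].
rewrite in_cut => /andP[xA yA] /r_of_covers.
rewrite /r xA (negbTE yA) inE xpair_eqE.
by case: eqP => _; case: eqP.
Qed.

Definition cyclic_pairs : {set 'I_n * 'I_n} := [set (x, ordS x) | x : 'I_n].

Lemma card_cyclic_pairs : #|cyclic_pairs| = n.
Proof. by rewrite card_imset ?card_ord // => x y []. Qed.

Lemma cyclic_pairs_pairs : 1 < n -> cyclic_pairs \subset pairs n.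
Proof.
move=> n1; apply/subsetP=> _ /imsetP[x _ ->]; rewrite inE /= -val_eqE /=.
have x_n := ltn_ord x.
have [xE|x_neq] := eqVneq x.+1 n; first by rewrite xE modnn; lia.
by rewrite modn_small; lia.
Qed.

(* Listing 'I_n cyclically downwards from [i] reverses every cyclic pair but
   (i, i + 1). *)
Lemma cyclic_pairs_sparse (p : 'I_n * 'I_n) :
    p \in pairs n ->
  exists2 pi : 'S_n, covers pi p & #|covered cyclic_pairs pi| <= 1.
Proof.
case: p => i j; rewrite inE -val_eqE /= => ij.
pose r (x : 'I_n) := if x <= i then i - x else i + n - x.
have [pi [covers_of_r r_of_covers]] := exists_perm_of_rank r; exists pi.
  by apply: covers_of_r; rewrite /r leqnn; have := ltn_ord j; case: ifP; lia.
rewrite -(cards1 (i, ordS i)); apply/subset_leq_card/subsetP=> c.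
case/setIdP=> /imsetP[x _ ->] /r_of_covers r_le.
suff -> : x = i by rewrite inE.
have x_n := ltn_ord x; have i_n := ltn_ord i.
apply: val_inj; move: r_le; rewrite /r /=; have [xE|x_neq] := eqVneq x.+1 n.
  by rewrite xE modnn leq0n; case: ifP; lia.
by rewrite modn_small; do 2?case: ifP; lia.
Qed.

Lemma cut_le_gamma (T : {set 'I_n * 'I_n}) (A : {set 'I_n}) :
  cut A \subset T -> T \subset pairs n -> #|cut A| <= gamma T.
Proof. by move=> AT /subsetP TP; apply: gamma_ge AT _ => p /TP /cut_sparse. Qed.

Lemma exists_cut_inversions (A : {set 'I_n}) :
  exists sigma : 'S_n, cut (sigma @: A) \subset inversions n.
Proof.
have [pi [covers_of_rank _]] := exists_perm_of_rank (fun x => x \in A : nat).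
exists (pi^-1)%g; apply/subsetP=> -[x y]; rewrite in_cut inE /=.
case/andP=> /imsetP[a aA ->].
rewrite -[y](permK pi) (mem_imset _ _ perm_inj) => yA.
by have := covers_of_rank (pi y) a; rewrite aA (negbTE yA) coversE; apply.
Qed.

Lemma exists_balanced_cut :
  exists2 A : {set 'I_n}, cut A \subset inversions n & #|cut A| = n ^ 2 %/ 4.
Proof.
have /card_gt0P[A] : 0 < #|[set A : {set 'I_n} | #|A| == n %/ 2]|.
  by rewrite card_draws bin_gt0 card_ord leq_div.
rewrite inE => /eqP cardA; have [sigma inv] := exists_cut_inversions A.
have cardI : #|sigma @: A| = n %/ 2 by rewrite card_imset //; apply: perm_inj.
exists (sigma @: A) => //.
by rewrite card_cut [#|~: _|]cardsCs setCK card_ord cardI sqr_div4.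
Qed.

End LowerBounds.

Lemma minset_complete_card_le n (T : {set 'I_n * 'I_n}) (P : {set 'S_n}) :
    1 < n -> T \subset pairs n -> minset (complete T) P ->
  #|P| <= maxn n (n ^ 2 %/ 4).
Proof.
move=> n1 TP /minset_completeP[_ [C CT crit]].
have [P3|P4] := leqP #|P| 3; rewrite leq_max; last first.
  by rewrite (critical_card_le crit (subset_trans CT TP) P4) orbT.
apply/orP; left; have [n3|n2] := leqP 3 n; first exact: leq_trans P3 n3.
apply: leq_trans (max_card _) _; rewrite card_Sn.
by have -> : n = 2 by lia.
Qed.

Lemma gamma_pairs n : 1 < n -> gamma (pairs n) = maxn n (n ^ 2 %/ 4).
Proof.
move=> n1; apply/eqP; rewrite eqn_leq; apply/andP; split.
  by apply/bigmax_leqP=> P; apply: minset_complete_card_le.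
have [A _ cardA] := exists_balanced_cut n.
rewrite geq_max -cardA cut_le_gamma ?cut_pairs // andbT.
rewrite -{1}(card_cyclic_pairs n).
exact: gamma_ge (cyclic_pairs_pairs n1) (@cyclic_pairs_sparse n).
Qed.

Section MaximumFamilies.

Variables (n : nat) (T : {set 'I_n * 'I_n}).
Hypotheses (n4 : 4 < n) (inv_T : inversions n \subset T).
Hypotheses (T_pairs : T \subset pairs n) (T_trans : transitive_pairs T).

Lemma gamma_sqr_div4 : gamma T = n ^ 2 %/ 4.
Proof.
apply/eqP; rewrite eqn_leq; apply/andP; split.
  rewrite -(maxn_idPr (leq_sqr_div4 (ltnW n4))); apply/bigmax_leqP=> P.
  by apply: minset_complete_card_le T_pairs; apply: ltn_trans n4.
have [A inv_A <-] := exists_balanced_cut n.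
exact: cut_le_gamma (subset_trans inv_A inv_T) T_pairs.
Qed.

Lemma maximum_minset_completeP (P : {set 'S_n}) :
  reflect [/\ pair_complete P, #|P| = n ^ 2 %/ 4
             & exists2 A, cut A \subset T & critical P (cut A)]
          (minset (complete T) P && (#|P| == gamma T)).
Proof.
rewrite gamma_sqr_div4; apply: (iffP andP).
  move=> [/minset_completeP[cP [C CT crit]] /eqP cardP].
  have C_pairs := subset_trans CT T_pairs.
  have cardC : #|C| = n ^ 2 %/ 4 by rewrite (critical_card crit).
  have {}cP : pair_complete P.
    exact: (extremal_critical_pair_complete crit _ _ _ CT T_trans).
  have [A CA] := extremal_critical_cut crit C_pairs n4 cardC cP.
  by split=> //; exists A; rewrite -CA.
move=> [cP -> [A AT crit]]; split=> //; apply/minset_completeP; split.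
  exact: complete_subset T_pairs cP.
by exists (cut A).
Qed.

End MaximumFamilies.

Section Relabelling.

Variables (n : nat) (tau : 'S_n).
Implicit Types (P : {set 'S_n}) (A : {set 'I_n}).

Lemma compsetE P : compset tau P = (P :* tau)%g.
Proof. by rewrite -rcosetE. Qed.

Lemma compset_critical P A :
  critical P (cut A) -> critical (compset tau P) (cut (tau @: A)).
Proof.
rewrite cut_imset; apply: critical_imset; first exact: mulIg.
  by move=> [x y] [u v] [/perm_inj -> /perm_inj ->].
by move=> pi [x y]; apply: coversM.
Qed.

Lemma compset_pair_complete P :
  pair_complete P -> pair_complete (compset tau P).
Proof.
move=> /completeP cP; apply/completeP=> -[x y]; rewrite inE /= => xy.
have [|pi piP cov] := cP ((tau^-1)%g x, (tau^-1)%g y).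
  by rewrite inE /= (inj_eq perm_inj).
exists (pi * tau)%g; first by rewrite compsetE mem_rcoset mulgK.
by rewrite -[x](permKV tau) -[y](permKV tau) coversM.
Qed.

End Relabelling.

Lemma compsetK n (tau : 'S_n) : cancel (compset tau) (compset tau^-1).
Proof. by move=> P; rewrite !compsetE rcosetK. Qed.

Section Sources.

Variable n : nat.
Implicit Types (P : {set 'S_n}) (A B : {set 'I_n}).

Definition source P : {set 'I_n} := odflt set0 [pick A | critical P (cut A)].

Lemma critical_source P A : critical P (cut A) -> critical P (cut (source P)).
Proof.
by move=> crit; rewrite /source; case: pickP => [//|/(_ A)]; rewrite crit.
Qed.

(* If neither set contains the other, take [x] in [A] only and [y] in [B] only:
   every permutation covers (x, y), in [cut A], or (y, x), in [cut B]. *)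
Lemma critical_cut_comparable P A B :
    2 < #|P| -> critical P (cut A) -> critical P (cut B) ->
  (A \subset B) || (B \subset A).
Proof.
move=> P3 critA critB; apply: contraTT P3; rewrite negb_or -leqNgt.
case/andP=> /subsetPn[x xA xB] /subsetPn[y yB yA].
have xy : x != y by apply: contraNneq xB => ->.
have [|pi piE] := critical_coverers (c := (x, y)) critA.
  by rewrite in_cut xA.
have [|rho rhoE] := critical_coverers (c := (y, x)) critB.
  by rewrite in_cut yB.
rewrite -[2]/(1 + 1) -{1}(cards1 pi) -(cards1 rho) -piE -rhoE.
apply: leq_trans (leq_card_setU _ _); apply/subset_leq_card/subsetP=> s sP.
by rewrite !inE sP (coversN _ xy) orbN.
Qed.

Lemma critical_cut_sub P A B :
    0 < #|P| -> critical P (cut A) -> critical P (cut B) -> A \subset B ->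
  B \subset A.
Proof.
move=> P_gt0 critA critB AB; apply/subsetP=> x xB; apply/negPn/negP=> xA.
have cut_neq0 D : critical P (cut D) -> exists c, c \in cut D.
  by move=> critD; apply/card_gt0P; rewrite (critical_card critD).
have [[a a'] /[!in_cut]/andP[aA _]] := cut_neq0 A critA.
have [[b' b] /[!in_cut]/andP[_ bB]] := cut_neq0 B critB.
have bA : b \notin A by apply: contra bB; apply: subsetP.
have xb : x != b by apply: contraNneq bB => <-.
have ax : a != x by apply: contraNneq xA => <-.
have [|||pi piP [cov_ab cov_xa]] := critical_covers_reverse
    (x := a) (y := b) (u := a) (v := x) critA (cut_pairs A).
- by rewrite /edge in_cut aA.
- by rewrite /edge in_cut aA.
- by rewrite xpair_eqE (negbTE xb) andbF.
have cov_xb := covers_trans cov_xa cov_ab.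
have [c /setP covE] := critical_covered critB piP.
have := covE (a, b); have := covE (x, b).
rewrite !inE !(subsetP AB a aA) xB bB cov_ab cov_xb => /esym/eqP <-.
by rewrite xpair_eqE (negbTE ax).
Qed.

Lemma critical_cut_inj P A B :
  2 < #|P| -> critical P (cut A) -> critical P (cut B) -> A = B.
Proof.
move=> P3 critA critB; have P_gt0 : 0 < #|P| by apply: ltn_trans P3.
by case/orP: (critical_cut_comparable P3 critA critB) => sub;
  apply/eqP; rewrite eqEsubset sub (critical_cut_sub P_gt0 _ _ sub).
Qed.

Lemma sourceE P A : 2 < #|P| -> critical P (cut A) -> source P = A.
Proof.
by move=> P3 crit; apply: critical_cut_inj P3 (critical_source crit) crit.
Qed.

Lemma cut_inversions_inj A B :
    cut A \subset inversions n -> cut B \subset inversions n -> #|A| = #|B| ->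
  A = B.
Proof.
move=> /subsetP invA /subsetP invB cardAB; apply/eqP/negPn/negP=> AB.
have /subsetPn[x xA xB] : ~~ (A \subset B).
  by apply: contra AB => AB; rewrite eqEcard AB cardAB leqnn.
have /subsetPn[y yB yA] : ~~ (B \subset A).
  by apply: contra AB => BA; rewrite eq_sym eqEcard BA cardAB leqnn.
have := invA (x, y); have := invB (y, x); rewrite !in_cut xA yB xB yA !inE /=.
by move=> /(_ isT) yx /(_ isT); rewrite ltnNge ltnW.
Qed.

End Sources.

Section StarFamilies.

Variable n : nat.
Hypothesis n4 : 4 < n.
Implicit Types (P Q : {set 'S_n}) (A : {set 'I_n}).

Lemma PstarP P :
  reflect [/\ pair_complete P, #|P| = n ^ 2 %/ 4 & critical P (cut (source P))]
          (P \in Pstar n).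
Proof.
rewrite inE; apply: (iffP (maximum_minset_completeP n4 _ _ _ _)).
- exact: inversions_pairs.
- by [].
- exact: pairs_transitive.
- by case=> cP cardP [A _ crit]; split=> //; apply: critical_source crit.
- by case=> cP cardP crit; split=> //; exists (source P); rewrite ?cut_pairs.
Qed.

Lemma Pstar_card_gt2 P : P \in Pstar n -> 2 < #|P|.
Proof. by case/PstarP=> _ -> _; have := ltn_sqr_div4 n4; lia. Qed.

Lemma in_Qstar Q :
  (Q \in Qstar n) = (Q \in Pstar n) && (cut (source Q) \subset inversions n).
Proof.
rewrite inE; apply/(maximum_minset_completeP n4 _ _ _ _)/andP.
- by [].
- exact: inversions_pairs.
- exact: inversions_transitive.
- case=> cQ cardQ [A inv_A crit]; have Qst : Q \in Pstar n.
    by apply/PstarP; split=> //; apply: critical_source crit.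
  by rewrite (sourceE (Pstar_card_gt2 Qst) crit).
- by case=> /PstarP[cQ cardQ crit] inv; split=> //; exists (source Q).
Qed.

Lemma mem_compset_Pstar tau P :
  (compset tau P \in Pstar n) = (P \in Pstar n).
Proof.
have compset_Pstar sigma R : R \in Pstar n -> compset sigma R \in Pstar n.
  case/PstarP=> cR cardR crit; apply/PstarP; split.
  - exact: compset_pair_complete.
  - by rewrite compsetE card_rcoset.
  - exact: (critical_source (compset_critical sigma crit)).
apply/idP/idP=> [/(compset_Pstar tau^-1)%g|]; last exact: compset_Pstar.
by rewrite compsetK.
Qed.

Lemma source_compset tau P :
  P \in Pstar n -> source (compset tau P) = tau @: source P.
Proof.
move=> Pst; apply: sourceE.
  by apply: Pstar_card_gt2; rewrite mem_compset_Pstar.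
by apply: compset_critical; case/PstarP: Pst.
Qed.

Lemma Pstar_compset :
  Pstar n = [set compset tau Q | tau in [set: 'S_n], Q in Qstar n].
Proof.
apply/setP=> P; apply/idP/imset2P => [Pst|[tau Q _]]; last first.
  by rewrite in_Qstar => /andP[Qst _] ->; rewrite mem_compset_Pstar.
have [sigma inv] := exists_cut_inversions (source P).
exists (sigma^-1)%g (compset sigma P); rewrite ?compsetK ?in_setT //.
by rewrite in_Qstar mem_compset_Pstar Pst source_compset.
Qed.

Lemma card_Pstar_source A :
  #|[set P in Pstar n | source P == A]| =
  #|[set Q in Qstar n | #|source Q| == #|A|]|.
Proof.
have [sigma inv] := exists_cut_inversions A.
have card_sigma (B : {set _}) : #|sigma @: B| = #|B|.
  by rewrite card_imset //; apply: perm_inj.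
rewrite -[RHS](card_preimset _ (can_inj (compsetK sigma))).
apply: eq_card => P; rewrite [LHS]inE 2![RHS]inE in_Qstar mem_compset_Pstar.
have [Pst|] := boolP (P \in Pstar n); last by rewrite ?andbF.
rewrite /= source_compset // card_sigma.
apply/eqP/andP=> [->|[inv_P /eqP cardP]]; first by rewrite eqxx inv.
apply/(imset_inj perm_inj)/(cut_inversions_inj inv_P inv).
by rewrite !card_sigma.
Qed.

Lemma bin_card_source P : P \in Pstar n -> 'C(n, #|source P|) = 'C(n, n %/ 2).
Proof.
case/PstarP=> _ cardP crit.
have [] := @sqr_div4_factor n #|source P| #|~: source P|.
- by rewrite cardsC card_ord.
- by rewrite -card_cut (critical_card crit).
- by move->.
- by move->; rewrite bin_sub ?leq_div.
Qed.

Lemma card_Pstar : #|Pstar n| = 'C(n, n %/ 2) * #|Qstar n|.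
Proof.
rewrite -sum1_card (partition_big (@source n) predT) //=.
transitivity
  (\sum_(A : {set 'I_n}) \sum_(Q in Qstar n | #|source Q| == #|A|) 1).
  by apply: eq_bigr => A _; rewrite !sum1dep_card card_Pstar_source.
rewrite (exchange_big_dep [in Qstar n]) => [|A Q _ /andP[] //].
rewrite mulnC -sum_nat_const; apply: eq_bigr => Q /= Qstar_Q.
have Qst : Q \in Pstar n by move: (Qstar_Q); rewrite in_Qstar => /andP[].
rewrite -(bin_card_source Qst) -[n in 'C(n, _)]card_ord -card_draws.
by rewrite -sum1dep_card; apply: eq_bigl => A; rewrite Qstar_Q eq_sym.
Qed.

End StarFamilies.

Lemma eq_card_bijective (T U : finType) :
  #|T| = #|U| -> exists f : T -> U, bijective f.
Proof.
move=> cardTU; exists (fun x => enum_val (cast_ord cardTU (enum_rank x))).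
exists (fun y => enum_val (cast_ord (esym cardTU) (enum_rank y))) => x.
  by rewrite enum_valK cast_ordK enum_rankK.
by rewrite enum_valK cast_ordKV enum_rankK.
Qed.

Theorem theorem2 (n : nat) (hn : 2 <= n) :
  [/\ gammaP n = maxn n (n ^ 2 %/ 4),
      (5 <= n ->
        Pstar n = [set compset tau Q | tau in [set: 'S_n], Q in Qstar n])
    & (5 <= n ->
        exists f : {P : {set 'S_n} | P \in Pstar n} ->
                   {D : {set 'I_n} | #|D| == n %/ 2} *
                   {Q : {set 'S_n} | Q \in Qstar n},
          bijective f)].
Proof.
split; [exact: gamma_pairs | exact: Pstar_compset | move=> n4].
apply: eq_card_bijective.
rewrite card_prod !card_sig card_Pstar // -[n in 'C(n, _)]card_ord.
by rewrite -card_draws cardsE.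
Qed.
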